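(* Let $\mathcal{U}$ be a quasi-definite vector of linear functionals, let $\{\mathcal{B}_m\}_{m\in\mathbb{N}}$ be the vector sequence of polynomials left-orthogonal with respect to $\mathcal{U}$, let $\widetilde{\mathcal{U}}=\mathcal{U}+\Lambda\,\boldsymbol{\delta}$, and let $\{\widetilde{\mathcal{B}}_m\}_{m\in\mathbb{N}}$ be the associated vector sequence of polynomials, i.e. satisfying $\widetilde{\mathcal{U}}(\widetilde{\mathcal{B}}_m)=0_{N\times N}$ for $m\ge1$ and $\widetilde{\mathcal{U}}(\widetilde{\mathcal{B}}_0)$ non-singular. Then $\widetilde{\mathcal{U}}$ is quasi-definite if and only if $$I_{N\times N}+\boldsymbol{\delta}_z(\mathcal{P}_0(z))\,\Lambda^T K_{m+1}(c_l,c_l),\qquad m\ge0,$$ is a non-singular matrix for every zero $c_l$ of $h$.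
   Context: Let $h(x)=\prod_{j=1}^M(x-c_j)^{M_j+1}$ with distinct zeros $c_1,\dots,c_M$ of multiplicities $M_j+1$, so $N=\deg h=M+\sum_{j=1}^MM_j$. Put $\mathcal{P}_0(x)=[1,x,\dots,x^{N-1}]^T$, $\mathcal{P}_j=h^j\mathcal{P}_0$. A vector of linear functionals $\mathcal{U}=[u^1,\dots,u^N]^T$ consists of linear functionals on $\mathbb{C}[x]$; for $\mathcal{P}=[p_1,\dots,p_N]^T$, $\mathcal{U}(\mathcal{P})$ is the $N\times N$ matrix with $(i,j)$ entry $\langle u^j,p_i\rangle$. One sets $(h^k\mathcal{U})(\mathcal{P})=\mathcal{U}(h^k\mathcal{P})$ and, for a matrix polynomial $G(z)=\sum_k\beta_kz^k$, $(G^T(h)\mathcal{U})(\mathcal{P})=\sum_k\mathcal{U}(h^k\mathcal{P})\beta_k$. Subscripts ($\mathcal{U}_x$, $\boldsymbol{\delta}_z$) indicate the variable acted on. The degree of $\mathcal{P}$ is $\lfloor(\max_j\deg p_j)/N\rfloor$. With $\mathcal{U}_j=\mathcal{U}(\mathcal{P}_j)$, $\mathcal{U}$ is quasi-definite if all leading principal submatrices of $[\mathcal{U}_{i+j}]_{i,j=0}^m$, $m\in\mathbb{N}$, are non-singular; this is the condition for the existence of left-orthogonal sequences. $\{\mathcal{B}_m\}$, $\deg\mathcal{B}_m=m$, is left-orthogonal with respect to $\mathcal{U}$ if $(h^k\mathcal{U})(\mathcal{B}_m)=\Delta_m\delta_{k,m}$, $k=0,\dots,m$, with $\Delta_m$ non-singular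 upper triangular. Write $\mathcal{B}_m(x)=V_m(h(x))\mathcal{P}_0(x)$ with $V_m$ a matrix polynomial of degree $m$, and let $\{G_m\}$ be the matrix polynomials, $\deg G_m=m$, with $((G_n(h(x)))^T\mathcal{U}_x)(\mathcal{B}_m)=I_{N\times N}\delta_{n,m}$. The kernel is $K_m(x,y)=\sum_{k=0}^{m-1}G_k(h(y))V_k(h(x))$; thus $K_{m+1}(c_l,c_l)=\sum_{k=0}^mG_k(0)V_k(0)$. $\Lambda$ is a numerical $N\times N$ matrix, $\boldsymbol{\delta}=[\delta_{c_1},\delta'_{c_1},\dots,\delta^{(M_1)}_{c_1},\dots,\delta_{c_M},\delta'_{c_M},\dots,\delta^{(M_M)}_{c_M}]^T$, where $\langle\delta_c^{(i)},p\rangle=(-1)^ip^{(i)}(c)$, and $(\Lambda\boldsymbol{\delta})(\mathcal{P})=\boldsymbol{\delta}(\mathcal{P})\Lambda^T$.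
   Formalization: Quasi-definite is read blockwise: the block matrices [U_{i+j}]_{i,j=0}^m are non-singular for every m, which is the condition for existence of left-orthogonal sequences; with leading principal minors of every scalar size the stated equivalence fails. *)

(* Defs.v *)
From HB Require Import structures.
From mathcomp Require Import all_boot all_order all_algebra.

Set Implicit Arguments.
Unset Strict Implicit.
Unset Printing Implicit Defensive.

Import GRing.Theory.
Local Open Scope ring_scope.

(* mu j is one less than the multiplicity of the zero c j. *)
Definition hpoly (F : fieldType) (M : nat) (c : 'I_M -> F) (mu : 'I_M -> nat) :
    {poly F} :=
  \prod_(j < M) ('X - (c j)%:P) ^+ (mu j).+1.

(* The degree of h. It is kept in the form \sum_i p_ i used by block matrices,
   so that tagnat.sig1 / tagnat.sig2 decode its indices lexicographically. *)
Definition hdeg (M : nat) (mu : 'I_M -> nat) : nat :=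
  (\sum_(j < M) (mu j).+1)%N.

Definition P0 (F : fieldType) (N : nat) : 'cV[{poly F}]_N :=
  \col_(i < N) 'X^i.

(* The floor of (max of the degrees) / N; a zero entry counts as degree 0. *)
Definition vdeg (F : fieldType) (N : nat) (P : 'cV[{poly F}]_N) : nat :=
  (\max_(i < N) (size (P i ord0)).-1) %/ N.

Definition vfun (F : fieldType) (N : nat) := 'I_N -> {scalar {poly F}}.

Definition vapp (F : fieldType) (N : nat) (U : vfun F N)
    (P : 'cV[{poly F}]_N) : 'M[F]_N :=
  \matrix_(i < N, j < N) U j (P i ord0).

(* Matrix polynomials are matrices with polynomial entries; size 0 is the zero
   matrix polynomial, and otherwise the degree is mpsize.-1. *)
Definition mpsize (F : fieldType) (N : nat) (G : 'M[{poly F}]_N) : nat :=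
  \max_(i < N) \max_(j < N) size (G i j).

Definition mpcoef (F : fieldType) (N : nat) (G : 'M[{poly F}]_N) (k : nat) :
    'M[F]_N :=
  map_mx (fun p : {poly F} => p`_k) G.

Definition mpeval (F : fieldType) (N : nat) (G : 'M[{poly F}]_N) (z : F) :
    'M[F]_N :=
  map_mx (fun p : {poly F} => p.[z]) G.

Definition mpcomp (F : fieldType) (N : nat) (G : 'M[{poly F}]_N)
    (h : {poly F}) : 'M[{poly F}]_N :=
  map_mx (fun p : {poly F} => p \Po h) G.

(* (h^k U)(P) *)
Definition hpow_vapp (F : fieldType) (N : nat) (h : {poly F}) (k : nat)
    (U : vfun F N) (P : 'cV[{poly F}]_N) : 'M[F]_N :=
  vapp U (h ^+ k *: P).

(* (G^T(h) U)(P) *)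
Definition mp_vapp (F : fieldType) (N : nat) (h : {poly F})
    (G : 'M[{poly F}]_N) (U : vfun F N) (P : 'cV[{poly F}]_N) : 'M[F]_N :=
  \sum_(k < mpsize G) hpow_vapp h k U P *m mpcoef G k.

(* The moment U(h^k P_0). *)
Definition moment (F : fieldType) (N : nat) (h : {poly F}) (U : vfun F N)
    (k : nat) : 'M[F]_N :=
  vapp U (h ^+ k *: P0 F N).

(* "Leading principal" is meant blockwise, with N x N blocks: this is what
   characterizes the existence of left-orthogonal sequences, whose members are
   determined up to an arbitrary non-singular left factor. *)
Definition quasi_definite (F : fieldType) (N : nat) (h : {poly F})
    (U : vfun F N) : Prop :=
  forall m : nat,
    \mxblock_(i < m.+1, j < m.+1) moment h U (i + j) \in unitmx.

(* is_trig_mx is lower triangularity, hence the transpose. *)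
Definition left_orthogonal (F : fieldType) (N : nat) (h : {poly F})
    (U : vfun F N) (B : nat -> 'cV[{poly F}]_N) : Prop :=
  (forall m, vdeg (B m) = m) /\
  exists D : nat -> 'M[F]_N,
    forall m, [/\ D m \in unitmx, is_trig_mx (D m)^T &
      forall k, (k <= m)%N ->
        hpow_vapp h k U (B m) = if k == m then D m else 0].

(* K_m(x, y) *)
Definition kernel (F : fieldType) (N : nat) (h : {poly F})
    (G V : nat -> 'M[{poly F}]_N) (m : nat) (x y : F) : 'M[F]_N :=
  \sum_(k < m) mpeval (G k) h.[y] *m mpeval (V k) h.[x].

Definition dirac_deriv (F : fieldType) (a : F) (i : nat) (p : {poly F}) : F :=
  (-1) ^+ i * p^`(i).[a].

Lemma dirac_deriv_linear (F : fieldType) (a : F) (i : nat) :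
  linear_for *%R (dirac_deriv a i).
Proof.
move=> k p q; rewrite /dirac_deriv derivnD derivnZ hornerD hornerZ mulrDr.
by rewrite mulrCA.
Qed.

HB.instance Definition _ (F : fieldType) (a : F) (i : nat) :=
  GRing.isLinear.Build F {poly F} F *%R (dirac_deriv a i)
    (dirac_deriv_linear a i).

Definition deltas (F : fieldType) (M : nat) (c : 'I_M -> F) (mu : 'I_M -> nat) :
    vfun F (hdeg mu) :=
  fun s => dirac_deriv (c (@tagnat.sig1 M (fun j => (mu j).+1) s))
                       (@tagnat.sig2 M (fun j => (mu j).+1) s).

Arguments deltas {F M} c mu _.

Definition vfun_comb (F : fieldType) (N : nat) (L : 'M[F]_N) (D : vfun F N)
    (i : 'I_N) (p : {poly F}) : F :=
  \sum_(j < N) L i j * D j p.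

Lemma vfun_comb_linear (F : fieldType) (N : nat) (L : 'M[F]_N) (D : vfun F N)
    (i : 'I_N) : linear_for *%R (vfun_comb L D i).
Proof.
move=> k p q; rewrite /vfun_comb mulr_sumr -big_split /=.
by apply: eq_bigr => j _; rewrite linearP /= mulrDr mulrCA.
Qed.

HB.instance Definition _ (F : fieldType) (N : nat) (L : 'M[F]_N) (D : vfun F N)
    (i : 'I_N) :=
  GRing.isLinear.Build F {poly F} F *%R (vfun_comb L D i)
    (vfun_comb_linear L D i).

(* L D, for a numerical matrix L and a vector of functionals D *)
Definition mx_vfun (F : fieldType) (N : nat) (L : 'M[F]_N) (D : vfun F N) :
    vfun F N :=
  fun i => vfun_comb L D i.

Lemma vapp_mx_vfun (F : fieldType) (N : nat) (L : 'M[F]_N) (D : vfun F N)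
    (P : 'cV[{poly F}]_N) :
  vapp (mx_vfun L D) P = vapp D P *m L^T.
Proof.
apply/matrixP => i j; rewrite !mxE; apply: eq_bigr => k _.
by rewrite !mxE mulrC.
Qed.

Definition add_vfun (F : fieldType) (N : nat) (U W : vfun F N) : vfun F N :=
  fun i => U i \+ W i.

(* Main.v *)
Require Import Defs.
From mathcomp Require Import all_boot all_order all_algebra.
From mathcomp Require Import reals.
From mathcomp Require Import complex.

Set Implicit Arguments.
Unset Strict Implicit.
Unset Printing Implicit Defensive.

Import GRing.Theory.
Local Open Scope ring_scope.
Local Open Scope complex_scope.

(** Quasi-definiteness is the invertibility, for every m, of the block Hankel
    matrix H built on the moments U_(i+j) with i, j <= m. The derivatives in
    delta stop short of the multiplicities of the zeros of h, so delta kills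
    all multiples of h (deltas_dvdp), and U + Lambda delta has the same moments
    as U except the one of index 0, which grows by D = delta(P_0) Lambda^T.
    Hence the block Hankel matrix of U + Lambda delta is H with D added to the
    corner block only, and the theorem is a matrix determinant lemma as soon as
    the corner block of H^-1 is recognised as K_(m+1)(c_l, c_l).

    This is where biorthogonality enters. Let LV be the block matrix whose row n
    lists the coefficients of V_n, and LG the one whose column n lists the
    coefficients of G_n. Expanding the polynomials in powers of h gives, for any
    functional W, the factorisation

      (LV * Hankel(W) * LG)_(k, n) = (G_n^T(h) W)(B_k)

    (mul_coef_moment). For W = U it reads LV H LG = 1, so that LV and LG are
    invertible and H^-1 = LG LV, whose corner block is the sum of the
    G_k(0) V_k(0), that is, the kernel at a zero of h. For W = U + Lambda delta
    the right-hand side becomes 1 + V_k(0) D G_n(0) blockwise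
    (mp_vapp_add_vfun), that is 1 + X Y with X the block column of the V_k(0)
    and Y the block row of the D G_n(0). Since 1 + X Y and 1 + Y X are
    simultaneously invertible (unitmx_1D_mulC), and Y X = D K_(m+1)(c_l, c_l),
    the equivalence holds separately for each m and each l. *)

(** * Simultaneous invertibility of 1 + XY and 1 + YX *)

(** If Z inverts 1 + X Y then 1 - Y Z X inverts 1 + Y X. *)
Lemma unitmx_1D_mul (F : fieldType) (m n : nat) (X : 'M[F]_(m, n))
    (Y : 'M[F]_(n, m)) :
  1%:M + X *m Y \in unitmx -> 1%:M + Y *m X \in unitmx.
Proof.
move=> uXY; set Z := invmx (1%:M + X *m Y).
have ZK : X *m Y *m Z = 1%:M - Z.
  by apply/eqP; rewrite eq_sym subr_eq addrC -{1}[Z]mul1mx -mulmxDl mulmxV.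
have: (1%:M + Y *m X) *m (1%:M - Y *m Z *m X) = 1%:M.
  rewrite mulmxBr mulmx1 mulmxDl mul1mx.
  have -> : Y *m X *m (Y *m Z *m X) = Y *m (X *m Y *m Z) *m X.
    by rewrite !mulmxA.
  by rewrite ZK mulmxBr mulmx1 mulmxBl [Y *m Z *m X + _]addrC subrK addrK.
by case/mulmx1_unit.
Qed.

Lemma unitmx_1D_mulC (F : fieldType) (m n : nat) (X : 'M[F]_(m, n))
    (Y : 'M[F]_(n, m)) :
  (1%:M + X *m Y \in unitmx) = (1%:M + Y *m X \in unitmx).
Proof. by apply/idP/idP; apply: unitmx_1D_mul. Qed.

(** * Expanding functionals in powers of h *)

Section Expansion.

Variables (F : fieldType) (N : nat) (h : {poly F}).
Implicit Types (U W : vfun F N) (P : 'cV[{poly F}]_N) (G V : 'M[{poly F}]_N).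

Lemma leq_size_mpsize G i j : (size (G i j) <= mpsize G)%N.
Proof.
apply: leq_trans (leq_bigmax i).
exact: (leq_bigmax (F := fun j => size (G i j)) j).
Qed.

Lemma mpcoef_default G k : (mpsize G <= k)%N -> mpcoef G k = 0.
Proof.
move=> leGk; apply/matrixP=> i j; rewrite !mxE; apply: nth_default.
exact: leq_trans (leq_size_mpsize G i j) leGk.
Qed.

Lemma mpeval0 G : mpeval G 0 = mpcoef G 0.
Proof. by apply/matrixP=> i j; rewrite !mxE horner_coef0. Qed.

Lemma mpcompE n G : (mpsize G <= n)%N ->
  mpcomp G h = \sum_(k < n) h ^+ k *: map_mx polyC (mpcoef G k).
Proof.
move=> leGn; apply/matrixP=> i j; rewrite !mxE summxE.
have size_le := leq_trans (leq_size_mpsize G i j) leGn.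
rewrite comp_polyE (big_ord_widen n (fun k => (G i j)`_k *: h ^+ k)) //.
rewrite big_mkcond; apply: eq_bigr => k _; rewrite !mxE.
case: ltnP => [_|le_k]; first by rewrite -mul_polyC mulrC.
by rewrite nth_default // mulr0.
Qed.

Lemma vapp_sum U n (P : 'I_n -> 'cV[{poly F}]_N) :
  vapp U (\sum_(k < n) P k) = \sum_(k < n) vapp U (P k).
Proof.
apply/matrixP=> i j; rewrite !mxE !summxE linear_sum.
by apply: eq_bigr => k _; rewrite mxE.
Qed.

Lemma vapp_mulmx U (A : 'M[F]_N) P :
  vapp U (map_mx polyC A *m P) = A *m vapp U P.
Proof.
apply/matrixP=> i j; rewrite !mxE linear_sum; apply: eq_bigr => k _.
by rewrite !mxE mul_polyC linearZ.
Qed.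

Lemma vapp_add_vfun U W P :
  vapp (add_vfun U W) P = vapp U P + vapp W P.
Proof. by apply/matrixP=> i j; rewrite !mxE. Qed.

Lemma hpow_vapp_mpcomp n k U V : (mpsize V <= n)%N ->
  hpow_vapp h k U (mpcomp V h *m P0 F N) =
  \sum_(i < n) mpcoef V i *m moment h U (i + k).
Proof.
move=> leVn; rewrite /hpow_vapp (mpcompE leVn) mulmx_suml scaler_sumr vapp_sum.
apply: eq_bigr => i _.
by rewrite -scalemxAl scalerA scalemxAr vapp_mulmx /moment -exprD addnC.
Qed.

Lemma mp_vapp_widen n G U P : (mpsize G <= n)%N ->
  mp_vapp h G U P = \sum_(k < n) hpow_vapp h k U P *m mpcoef G k.
Proof.
move=> leGn; rewrite /mp_vapp.
rewrite (big_ord_widen n (fun k => hpow_vapp h k U P *m mpcoef G k)) //.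
rewrite big_mkcond; apply: eq_bigr => k _.
by case: ltnP => // le_k; rewrite mpcoef_default // mulmx0.
Qed.

(** The Hankel structure comes from h^i h^j = h^(i+j): the power i is carried
    by the polynomial, the power j by the functional. *)
Lemma mul_coef_moment n U (V G : nat -> 'M[{poly F}]_N) :
  (forall k, (k < n)%N -> mpsize (V k) <= n)%N ->
  (forall k, (k < n)%N -> mpsize (G k) <= n)%N ->
  \mxblock_(k < n, i < n) mpcoef (V k) i *m
    \mxblock_(i < n, j < n) moment h U (i + j) *m
    \mxblock_(j < n, l < n) mpcoef (G l) j =
  \mxblock_(k < n, l < n) mp_vapp h (G l) U (mpcomp (V k) h *m P0 F N).
Proof.
move=> leV leG; rewrite !mul_mxblock; apply: eq_mxblock => k l.
rewrite (mp_vapp_widen _ _ (leG l (ltn_ord l))); apply: eq_bigr => j _.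
by rewrite (hpow_vapp_mpcomp _ _ (leV k (ltn_ord k))).
Qed.

(** A functional W vanishing on the multiples of h sees V(h) only through V(0)
    and G(h) only through G(0). *)
Lemma mp_vapp_add_vfun U W V G :
  (forall i p, h %| p -> W i p = 0) -> (0 < mpsize V)%N -> (0 < mpsize G)%N ->
  mp_vapp h G (add_vfun U W) (mpcomp V h *m P0 F N) =
  mp_vapp h G U (mpcomp V h *m P0 F N) +
  mpeval V 0 *m vapp W (P0 F N) *m mpeval G 0.
Proof.
move=> Wh V0 G0.
have hpowW0 k P : hpow_vapp h k.+1 W P = 0.
  by apply/matrixP=> i j; rewrite !mxE Wh // exprS -mulrA dvdp_mulr.
have momentW0 k : moment h W k.+1 = 0 by exact: hpowW0.
rewrite {1}/mp_vapp.
under eq_bigr => k _ do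
  rewrite {1}/hpow_vapp vapp_add_vfun mulmxDl -!/(hpow_vapp _ _ _ _).
rewrite big_split /=; congr (_ + _).
case: (mpsize G) G0 => // g _; rewrite big_ord_recl big1 ?addr0; last first.
  by move=> k _; rewrite hpowW0 mul0mx.
rewrite (hpow_vapp_mpcomp _ _ (leqnn _)).
case: (mpsize V) V0 => // v _; rewrite big_ord_recl big1 ?addr0; last first.
  by move=> k _; rewrite addn0 momentW0 mulmx0.
by rewrite /moment expr0 scale1r !mpeval0.
Qed.

End Expansion.

(** * Perturbing the moment of index 0 *)

(** The truncation m is the same on both sides, so quasi-definiteness is never
    transported between different sizes. The kernel is the block of index (0, 0)
    of the inverse of the Hankel matrix of U, the only one that W meets. *)
Lemma unitmx_moment_add_vfun (F : fieldType) (N : nat) (h : {poly F})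
    (U W : vfun F N) (V G : nat -> 'M[{poly F}]_N) (m : nat) (z : F) :
  h.[z] = 0 -> (forall i p, h %| p -> W i p = 0) ->
  (forall k, mpsize (V k) = k.+1) -> (forall k, mpsize (G k) = k.+1) ->
  (forall n k, mp_vapp h (G n) U (mpcomp (V k) h *m P0 F N) =
               if n == k then 1%:M else 0) ->
  (\mxblock_(i < m.+1, j < m.+1) moment h (add_vfun U W) (i + j) \in unitmx) =
  (1%:M + vapp W (P0 F N) *m kernel h G V m.+1 z z \in unitmx).
Proof.
move=> hz Wh sV sG biorth.
have leV k : (k < m.+1)%N -> (mpsize (V k) <= m.+1)%N by rewrite sV.
have leG k : (k < m.+1)%N -> (mpsize (G k) <= m.+1)%N by rewrite sG.
set D := vapp W _.
set LV := \mxblock_(k < m.+1, i < m.+1) mpcoef (V k) i.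
set LG := \mxblock_(j < m.+1, l < m.+1) mpcoef (G l) j.
have biorth1 : \mxblock_(k < m.+1, l < m.+1)
    mp_vapp h (G l) U (mpcomp (V k) h *m P0 F N) = 1%:M.
  have -> : 1%:M = \mxdiag_(k < m.+1) (1%:M : 'M[F]_N) by rewrite mxdiagZ.
  apply: eq_mxblock => k l; rewrite biorth (inj_eq val_inj) eq_sym.
  by case: eqVneq => _; rewrite ?conform_mx_id.
have [uLV uLG] : LV \in unitmx /\ LG \in unitmx.
  have E := mul_coef_moment h U leV leG; rewrite biorth1 in E.
  have [+ ->] := mulmx1_unit E.
  by rewrite unitmx_mul => /andP[-> _].
have perturbed : \mxblock_(k < m.+1, l < m.+1)
    mp_vapp h (G l) (add_vfun U W) (mpcomp (V k) h *m P0 F N) =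
    1%:M + \mxcol_(k < m.+1) mpeval (V k) 0 *m
           \mxrow_(l < m.+1) (D *m mpeval (G l) 0).
  rewrite -biorth1 mul_mxcol_mxrow -mxblockD; apply: eq_mxblock => k l.
  by rewrite mulmxA mp_vapp_add_vfun ?sV ?sG.
transitivity (LV *m \mxblock_(i < m.+1, j < m.+1) moment h (add_vfun U W) (i + j)
  *m LG \in unitmx); first by rewrite !unitmx_mul uLV uLG andbT.
rewrite (mul_coef_moment h (add_vfun U W) leV leG) perturbed.
rewrite [LHS]unitmx_1D_mulC mul_mxrow_mxcol /kernel hz mulmx_sumr.
by under eq_bigr do rewrite -mulmxA.
Qed.

(** * Delta at the zeros of h *)

Lemma horner_derivn_mulXsubC (F : fieldType) (a : F) (n i : nat) (q : {poly F}) :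
  (i < n)%N -> ((('X - a%:P) ^+ n * q)^`(i)).[a] = 0.
Proof.
elim: n i q => // n IHn [|i] q lt_in.
  by rewrite derivn0 hornerM horner_exp hornerXsubC subrr expr0n mul0r.
rewrite derivSn derivM deriv_exp derivXsubC mul1r /= exprS.
have -> : ('X - a%:P) ^+ n *+ n.+1 * q + ('X - a%:P) * ('X - a%:P) ^+ n * q^`() =
    ('X - a%:P) ^+ n * (q *+ n.+1 + ('X - a%:P) * q^`()).
  by rewrite mulrDr mulrnAl mulrnAr mulrA [_ ^+ n * ('X - _)]mulrC.
exact: IHn.
Qed.

Section Deltas.

Variables (F : fieldType) (M : nat) (c : 'I_M -> F) (mu : 'I_M -> nat).

Lemma hpoly_root l : (hpoly c mu).[c l] = 0.
Proof.
apply/eqP; rewrite /hpoly (bigD1 l) //= hornerM horner_exp hornerXsubC subrr.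
by rewrite expr0n mul0r.
Qed.

(** The order of differentiation at c_j is at most mu_j, while c_j is a zero of
    multiplicity at least mu_j + 1 of every multiple of h. *)
Lemma deltas_dvdp s p : hpoly c mu %| p -> deltas c mu s p = 0.
Proof.
case/dvdpP=> q ->; rewrite /deltas /= /dirac_deriv [q * _]mulrC.
rewrite /hpoly (bigD1 (tagnat.sig1 s)) //= -mulrA.
by rewrite horner_derivn_mulXsubC ?mulr0.
Qed.

End Deltas.

Theorem theorem4 (R : realType) (M : nat) (c : 'I_M -> R[i])
    (mu : 'I_M -> nat)
    (U : vfun R[i] (hdeg mu))
    (B : nat -> 'cV[{poly R[i]}]_(hdeg mu))
    (V G : nat -> 'M[{poly R[i]}]_(hdeg mu))
    (Lambda : 'M[R[i]]_(hdeg mu))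
    (Bt : nat -> 'cV[{poly R[i]}]_(hdeg mu)) :
  let h := hpoly c mu in
  let delta := deltas c mu in
  let Ut := add_vfun U (mx_vfun Lambda delta) in
  (0 < M)%N ->
  injective c ->
  quasi_definite h U ->
  left_orthogonal h U B ->
  (forall m, mpsize (V m) = m.+1) ->
  (forall m, B m = mpcomp (V m) h *m P0 R[i] (hdeg mu)) ->
  (forall m, mpsize (G m) = m.+1) ->
  (forall n m, mp_vapp h (G n) U (B m) = if n == m then 1%:M else 0) ->
  (forall m, (1 <= m)%N -> vapp Ut (Bt m) = 0) ->
  vapp Ut (Bt 0%N) \in unitmx ->
  quasi_definite h Ut <->
  (forall (m : nat) (l : 'I_M),
     1%:M + vapp delta (P0 R[i] (hdeg mu)) *m Lambda^T
            *m kernel h G V m.+1 (c l) (c l) \in unitmx).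
Proof.
move=> h delta Ut M_gt0 _ _ _ sV BE sG biorth _ _.
have mxdelta0 i p : h %| p -> mx_vfun Lambda delta i p = 0.
  move=> hp; rewrite /mx_vfun /= /vfun_comb big1 // => j _.
  by rewrite /delta deltas_dvdp ?mulr0.
have biorthV n k : mp_vapp h (G n) U (mpcomp (V k) h *m P0 R[i] (hdeg mu)) =
    if n == k then 1%:M else 0 by rewrite -BE.
have unitE m l := unitmx_moment_add_vfun m (hpoly_root c mu l) mxdelta0
  sV sG biorthV.
split=> [qd m l|nonsing m]; first by rewrite -vapp_mx_vfun -unitE; exact: qd.
by rewrite (unitE m (Ordinal M_gt0)) vapp_mx_vfun.
Qed.
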